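(* Let $\mathcal{L}(R_{k_1},\ldots,R_{k_p})$, $(k_1,\ldots,k_p)\in\mathbb{Z}^p$, be a family of oriented link diagrams which coincide outside $p$ disjoint discs and which in the $j$-th disc contain the 2-strand braid $x_1^{k_j}$ with both strands oriented in parallel (top to bottom). Let $\nabla_{\mathcal{L}}(k_1,\ldots,k_p)(s)$ be the Alexander-Conway polynomial of $\mathcal{L}(R_{k_1},\ldots,R_{k_p})$, and for $a\in\mathbb{Z}$ put $C^{a}(s)=(-1)^a s^{a-1}+s^{1-a}$. Then for all $k_1,\ldots,k_p\in\mathbb{Z}$, $$\nabla_{\mathcal{L}}(k_1,\ldots,k_p)(s)=\Big(\frac{s}{s^2+1}\Big)^{p}\sum_{0\le j_1,\ldots,j_p\le 1}C^{k_1+j_1}(s)\cdots C^{k_p+j_p}(s)\,\nabla_{\mathcal{L}}(j_1,\ldots,j_p)(s).$$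
   Context: The Alexander-Conway polynomial (in the variable $s$, where $t=s^{-2}$ for the usual variable $t$) is the oriented link invariant $\nabla$ with values in $\mathbb{C}[s,s^{-1}]$ determined by $\nabla(\bigcirc)=1$ (unknot) and the skein relation $\nabla(L_-)-(s^{-1}-s)\nabla(L_0)-\nabla(L_+)=0$ whenever $L_+,L_-,L_0$ are oriented diagrams identical except near one crossing, where $L_+$ has a positive crossing (both strands pointing up, the over-strand goes from lower left to upper right), $L_-$ a negative crossing and $L_0$ the oriented smoothing. The 2-strand braid $x_1$ (generator of $\mathcal{B}_2$) is the crossing in which the strand going from top left to bottom right passes over the strand going from top right to bottom left; with both strands oriented from top to bottom it is a negative crossing (type $L_-$), and $x_1^{-1}$ is a positive crossing. *)

(* Defs.v *)
(* Oriented link diagrams are presented in Morse position, read from top to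
   bottom as words in the elementary pieces cap (local maximum), cup (local
   minimum) and crossing; every link diagram is of this form up to an isotopy
   of the plane, and two words present diagrams which differ by an isotopy of
   the plane iff they are [planar_isotopic]. *)
From Stdlib Require Import Relation_Operators.
From HB Require Import structures.
From mathcomp Require Import all_boot all_order all_algebra.
From mathcomp Require Import reals complex.

Set Implicit Arguments.
Unset Strict Implicit.
Unset Printing Implicit Defensive.
Import GRing.Theory.

(* The orientations of the strands met by a horizontal line, from left to
   right: [true] for a strand going down, [false] for a strand going up. *)
Definition level := seq bool.

(* In [Cap d], d is the orientation of the left leg.
   [Cross true] is the crossing x_1, in which the strand joining top left to
   bottom right is over the strand joining top right to bottom left;
   [Cross false] is x_1^-1, in which it is under.  A crossing has any
   orientation: it is given by the level at which the crossing occurs. *)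
Inductive elementary := Cap of bool | Cup | Cross of bool.

Definition arity (e : elementary) : nat := if e is Cap _ then 0 else 2.
Definition coarity (e : elementary) : nat := if e is Cup then 0 else 2.

Definition elementary_out (e : elementary) (l : level) : option level :=
  match e, l with
  | Cap d, [::] => Some [:: d; ~~ d]
  | Cup, [:: a; b] => if a != b then Some [::] else None
  | Cross _, [:: a; b] => Some [:: b; a]
  | _, _ => None
  end.

(* [(i, e)] has i strands on the left of e. *)
Definition slice := (nat * elementary)%type.
Definition word := seq slice.

Definition strands (i n : nat) (l : level) : level := take n (drop i l).

Definition slice_out (x : slice) (l : level) : option level :=
  let: (i, e) := x in
  if i <= size l then
    omap (fun out => take i l ++ out ++ drop (i + arity e) l)
         (elementary_out e (strands i (arity e) l))
  else None.

Fixpoint word_out (w : word) (l : level) : option level :=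
  if w is x :: w' then obind (word_out w') (slice_out x l) else Some l.

Record link_diagram := LinkDiagram {
  diagram_word :> word;
  diagram_closed : word_out diagram_word [::] = Some [::] }.

(* Exchange of heights of two pieces far apart, cancellation of a maximum with
   a minimum, and rotation of a crossing past a maximum or a minimum. *)
Inductive planar_move : word -> word -> Prop :=
| Exchange i m e1 e2 :
    planar_move [:: (i + arity e1 + m, e2); (i, e1)]
                [:: (i, e1); (i + coarity e1 + m, e2)]
| SnakeL i d : planar_move [:: (i, Cap d); (i.+1, Cup)] [::]
| SnakeR i d : planar_move [:: (i.+1, Cap d); (i, Cup)] [::]
| SlideCap i d b :
    planar_move [:: (i, Cap d); (i.+1, Cross b)]
                [:: (i.+1, Cap d); (i, Cross (~~ b))]
| SlideCup i b :
    planar_move [:: (i, Cross b); (i.+1, Cup)]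
                [:: (i.+1, Cross (~~ b)); (i, Cup)].

(* The crossing in [R1Cap] exchanges the legs, hence the orientation [~~ d]. *)
Inductive reidemeister_move : word -> word -> Prop :=
| R1Cap i d b :
    reidemeister_move [:: (i, Cap d); (i, Cross b)] [:: (i, Cap (~~ d))]
| R1Cup i b : reidemeister_move [:: (i, Cross b); (i, Cup)] [:: (i, Cup)]
| R2 i b : reidemeister_move [:: (i, Cross b); (i, Cross (~~ b))] [::]
| R3 i b :
    reidemeister_move [:: (i, Cross b); (i.+1, Cross b); (i, Cross b)]
                      [:: (i.+1, Cross b); (i, Cross b); (i.+1, Cross b)].

(* The type of the two sides ensures that only diagrams with coherent
   orientations are related. *)
Definition in_context (move : word -> word -> Prop) (D D' : link_diagram) :=
  exists u v x y, [/\ move x y, diagram_word D = u ++ x ++ v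
                    & diagram_word D' = u ++ y ++ v].

Definition planar_isotopic : link_diagram -> link_diagram -> Prop :=
  clos_refl_sym_trans _ (in_context planar_move).

Definition isotopic : link_diagram -> link_diagram -> Prop :=
  clos_refl_sym_trans _
    (in_context (fun x y => planar_move x y \/ reidemeister_move x y)).

(* The signs and the oriented smoothing of a crossing whose top left and top
   right ends have orientations [a1] and [a2].  When both strands go up, or both
   go down, x_1 is negative and the smoothing is a pair of vertical strands; when
   both strands go to the right, or both to the left, a quarter turn shows that
   x_1 is positive, and the smoothing is a cup above a cap. *)
Definition positive_crossing (a1 a2 : bool) : elementary := Cross (a1 != a2).
Definition negative_crossing (a1 a2 : bool) : elementary := Cross (a1 == a2).
Definition smoothing (i : nat) (a1 a2 : bool) : word :=
  if a1 == a2 then [::] else [:: (i, Cup); (i, Cap a2)].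

Definition skein_triple (Lp Lm L0 : link_diagram) : Prop :=
  exists (u v : word) (i : nat) (l : level) (a1 a2 : bool),
    [/\ word_out u [::] = Some l /\ strands i 2 l = [:: a1; a2],
        diagram_word Lp = u ++ (i, positive_crossing a1 a2) :: v,
        diagram_word Lm = u ++ (i, negative_crossing a1 a2) :: v
      & diagram_word L0 = u ++ smoothing i a1 a2 ++ v].

Section AlexanderConway.
Local Open Scope ring_scope.
Variable R : realType.

(* The field C(s), which contains C[s, s^-1]. *)
Definition ratfun := {fraction {poly R[i]}}.

Definition s : ratfun := tofrac 'X.

Definition is_laurent (f : ratfun) : Prop :=
  exists (q : {poly R[i]}) (n : nat), f = tofrac q / s ^+ n.

Definition is_alexander_conway (nabla : link_diagram -> ratfun) : Prop :=
  [/\ forall D, is_laurent (nabla D),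
      forall D D', isotopic D D' -> nabla D = nabla D',
      forall D d, diagram_word D = [:: (0%N, Cap d); (0%N, Cup)] -> nabla D = 1
    & forall Lp Lm L0, skein_triple Lp Lm L0 ->
        nabla Lm - (s^-1 - s) * nabla L0 - nabla Lp = 0].

Definition C_ (a : int) : ratfun := (-1) ^ a * s ^ (a - 1) + s ^ (1 - a).

End AlexanderConway.

(* A diagram with p discs: [Disc j i] is the j-th disc, with i strands on its
   left; two parallel strands enter it from the top and leave at the bottom. *)
Inductive piece (p : nat) := Fixed of slice | Disc of 'I_p & nat.
Arguments Fixed {p}.

Definition piece_out p (x : piece p) (l : level) : option level :=
  match x with
  | Fixed e => slice_out e l
  | Disc _ i => if strands i 2 l == [:: true; true] then Some l else None
  end.

Fixpoint template_out p (T : seq (piece p)) (l : level) : option level :=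
  if T is x :: T' then obind (template_out T') (piece_out x l) else Some l.

Definition disc_label p (x : piece p) : option 'I_p :=
  if x is Disc j _ then Some j else None.

Definition is_template p (T : seq (piece p)) : Prop :=
  template_out T [::] = Some [::] /\ perm_eq (pmap (@disc_label p) T) (enum 'I_p).

(* The 2-strand braid x_1^k with i strands on its left. *)
Definition twist (i : nat) (k : int) : word :=
  nseq `|k|%N (i, Cross (0 <= k)%R).

Definition fill_piece p (k : {ffun 'I_p -> int}) (x : piece p) : word :=
  match x with
  | Fixed e => [:: e]
  | Disc j i => twist i (k j)
  end.

Definition fill p (T : seq (piece p)) (k : {ffun 'I_p -> int}) : word :=
  flatten (map (fill_piece k) T).

(* The isotopy of the plane puts the discs in the vertical position of a
   template; words presenting the same diagram are not distinguished. *)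
Definition parallel_braid_family p
    (L : {ffun 'I_p -> int} -> link_diagram) : Prop :=
  exists2 T : seq (piece p), is_template T &
    forall k, exists2 D : link_diagram,
      diagram_word D = fill T k & planar_isotopic D (L k).

(* Main.v *)
(* The skein relation at a crossing put in front of [x_1^m] says that [nabla],
   as a function of the exponent of a single disc, solves the linear recurrence
   f (m + 1) = (s^-1 - s) f m + f (m - 1), whose characteristic roots are s^-1
   and - s.  So does every shift of [C_], hence also the right hand side.
   A solution in all the exponents is determined by its values on {0, 1}^p, and
   there the two sides agree because s / (s^2 + 1) * C^(a + b) is the Kronecker
   delta for a, b in {0, 1}. *)
Require Import Defs.
From mathcomp Require Import all_boot all_order all_algebra.
From mathcomp Require Import reals complex.
From mathcomp Require Import ring zify.
From Stdlib Require Import Relation_Operators.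

Set Implicit Arguments.
Unset Strict Implicit.
Unset Printing Implicit Defensive.
Import GRing.Theory.

(** * Levels along a word, and fillings of a template *)

Lemma word_out_cons x w l : word_out (x :: w) l = obind (word_out w) (slice_out x l).
Proof. by []. Qed.

Lemma word_out_cat u v l : word_out (u ++ v) l = obind (word_out v) (word_out u l).
Proof. by elim: u l => //= x u IH l; case: slice_out. Qed.

Lemma template_out_cat p (T U : seq (piece p)) l :
  template_out (T ++ U) l = obind (template_out U) (template_out T l).
Proof. by elim: T l => //= x T IH l; case: piece_out. Qed.

(** A crossing only exchanges the two orientations at its ends, and here they are equal. *)
Lemma slice_out_parallel i b l :
  strands i 2 l = [:: true; true] -> slice_out (i, Cross b) l = Some l.
Proof.
rewrite /slice_out /strands => Hl.
have il : i <= size l.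
  by rewrite leqNgt; apply/negP => il; rewrite drop_oversize ?(ltnW il) in Hl.
rewrite il Hl /=; congr Some.
by rewrite -{3}(cat_take_drop i l) -(cat_take_drop 2 (drop i l)) Hl drop_drop addnC.
Qed.

Lemma word_out_twist i k l :
  strands i 2 l = [:: true; true] -> word_out (twist i k) l = Some l.
Proof.
move=> Hl; rewrite /twist; elim: `|k|%N => // n IH.
by rewrite [nseq _ _]/= word_out_cons slice_out_parallel.
Qed.

Lemma word_out_fill p (T : seq (piece p)) k l l' :
  template_out T l = Some l' -> word_out (fill T k) l = Some l'.
Proof.
elim: T l => //= x T IH l.
rewrite /fill /= word_out_cat.
case: x => [e|j i] /=; first by case: slice_out => //= l1 /IH.
by case: eqP => //= Hl /IH; rewrite word_out_twist.
Qed.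

Lemma eq_fill p (T : seq (piece p)) (j : 'I_p) (k k' : {ffun 'I_p -> int}) :
  j \notin pmap (@disc_label p) T -> (forall x, x != j -> k x = k' x) ->
  fill T k = fill T k'.
Proof.
move=> + kk'; elim: T => //= x T IH.
rewrite /fill /=; case: x => [e|x i] /=; first by move/IH; rewrite /fill => ->.
rewrite inE negb_or eq_sym => /andP[xj /IH]; rewrite /fill => ->.
by rewrite kk'.
Qed.

Lemma split_disc p (T : seq (piece p)) (j : 'I_p) :
  j \in pmap (@disc_label p) T ->
  exists T1 i T2, T = T1 ++ Disc j i :: T2.
Proof.
elim: T => //= -[e|x i] T IH /=.
  by move=> /IH[T1 [i [T2 ->]]]; exists (Fixed e :: T1), i, T2.
rewrite inE; case: eqP => [-> _|_ /=]; first by exists [::], i, T.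
by move=> /IH[T1 [i' [T2 ->]]]; exists (Disc x i :: T1), i', T2.
Qed.

(** * Isotopies of link diagrams and of twists *)

Lemma link_diagram_inj (D D' : link_diagram) :
  diagram_word D = diagram_word D' -> D = D'.
Proof.
case: D D' => [w c] [w' c'] /= E; rewrite -E in c' *.
(* Closedness is an equation in a type with decidable equality, so it has only one proof. *)
by rewrite (eq_irrelevance c c').
Qed.

Lemma isotopic_planar D D' : planar_isotopic D D' -> isotopic D D'.
Proof.
elim=> [E E' [u [v [x [y [xy uE vE]]]]]|E|E E' _|E E' E'' _ + _].
- by apply: rst_step; exists u, v, x, y; split=> //; left.
- exact: rst_refl.
- exact: rst_sym.
- exact: rst_trans.
Qed.

Local Open Scope ring_scope.

(** Either the new crossing lengthens the twist, or the twist starts with the inverse crossing and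
    the two form a pair that [R2] removes. *)
Lemma twist_cross i b k (k' := if b then k + 1 else k - 1) :
  (i, Cross b) :: twist i k = twist i k' \/
  (i, Cross b) :: twist i k = [:: (i, Cross b); (i, Cross (~~ b))] ++ twist i k'.
Proof.
rewrite {}/k' /twist; case: b; case: k => [n|n].
- by left; have -> : n%:Z + 1 = n.+1%:Z by lia.
- right; have -> : Negz n + 1 = - n%:Z by lia.
  (* At exponent 0 the sign test of [twist] switches sides, but the word is empty there. *)
  by case: n => [|n] //; rewrite abszN.
- case: n => [|n]; first by left.
  by right; have -> : n.+1%:Z - 1 = n%:Z by lia.
- by left; have -> : Negz n - 1 = Negz n.+1 by lia.
Qed.

Lemma isotopic_twist_cross (D D' : link_diagram) u v i b k :
  diagram_word D = u ++ (i, Cross b) :: twist i k ++ v ->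
  diagram_word D' = u ++ twist i (if b then k + 1 else k - 1) ++ v ->
  isotopic D D'.
Proof.
rewrite -cat_cons; case: (twist_cross i b k) => -> HD HD'.
  by rewrite (link_diagram_inj (etrans HD (esym HD'))); apply: rst_refl.
apply: rst_step; exists u, (twist i (if b then k + 1 else k - 1) ++ v).
exists [:: (i, Cross b); (i, Cross (~~ b))], [::].
by split=> //; right; constructor.
Qed.

(** * Uniqueness for the recurrence, in one and in several exponents *)

Definition update p (k : {ffun 'I_p -> int}) (j : 'I_p) (m : int) :
  {ffun 'I_p -> int} := [ffun x => if x == j then m else k x].

Lemma update_id p (k : {ffun 'I_p -> int}) j : update k j (k j) = k.
Proof. by apply/ffunP => x; rewrite ffunE; case: eqP => // ->. Qed.

Definition twist_rec (F : fieldType) (s : F) (f : int -> F) : Prop :=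
  forall m, f (m + 1) = (s^-1 - s) * f m + f (m - 1).

(** Since [f (m - 1)] has coefficient 1, the recurrence runs backwards as well as forwards; each
    induction carries two consecutive values. *)
Lemma twist_rec_eq0 (F : fieldType) (s : F) (f : int -> F) :
  twist_rec s f -> f 0 = 0 -> f 1 = 0 -> forall m, f m = 0.
Proof.
move=> rec f0 f1.
have fpos (n : nat) : f n%:Z = 0 /\ f n.+1%:Z = 0.
  elim: n => // n [fn fn1]; split=> //.
  have -> : n.+2%:Z = n.+1%:Z + 1 by lia.
  have En : n.+1%:Z - 1 = n%:Z by lia.
  by rewrite rec En fn fn1; ring.
have fneg (n : nat) : f (- n%:Z) = 0 /\ f (- n%:Z + 1) = 0.
  elim: n => // n [fn fn1].
  have En : - n.+1%:Z + 1 = - n%:Z by lia.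
  rewrite En; split=> //.
  have := rec (- n%:Z); rewrite fn fn1 mulr0 add0r => ->.
  by congr f; lia.
move=> [n|n]; first by case: (fpos n).
by rewrite NegzE; case: (fneg n.+1).
Qed.

(** Induction on the number of exponents outside {0, 1}: moving one of them to 0 or 1 lowers this
    number, and the recurrence in that exponent then carries the vanishing back to its actual
    value. *)
Lemma multi_twist_rec_eq0 (F : fieldType) (s : F) p
    (h : {ffun 'I_p -> int} -> F) :
  (forall k j, twist_rec s (fun m => h (update k j m))) ->
  (forall k : {ffun 'I_p -> 'I_2}, h [ffun l => (k l : nat)%:Z] = 0) ->
  forall k, h k = 0.
Proof.
move=> rec h01 k.
have [n] := ubnP #|[set l | (k l != 0) && (k l != 1)]|.
elim: n k => // n IH k; rewrite ltnS => kn.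
have [kE|[l]] := set_0Vmem [set l | (k l != 0) && (k l != 1)].
  have k01 l : (k l == 0) || (k l == 1).
    by have := in_set0 l; rewrite -kE inE -negb_or => /negbFE.
  rewrite -(h01 [ffun l => if k l == 0 then ord0 else ord_max]).
  congr h; apply/ffunP => l; rewrite !ffunE.
  by have := k01 l; case: eqP => [->|_ /= /eqP].
rewrite inE => lk; rewrite -(update_id k l).
have h_small m : (m == 0) || (m == 1) -> h (update k l m) = 0.
  move=> m01; apply: IH; apply: leq_trans kn; apply: proper_card.
  apply/properP; split.
    apply/subsetP => x; rewrite !inE ffunE; case: (x == l) => //.
    by rewrite -negb_or m01.
  by exists l; rewrite inE // ffunE eqxx -negb_or m01.
by apply: (twist_rec_eq0 (rec k l)); apply: h_small.
Qed.

(** * The coefficients of the expansion *)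

Section TwistCoefficients.
Variables (F : fieldType) (s : F).
Hypotheses (s_neq0 : s != 0) (s2_neq0 : s ^+ 2 + 1 != 0).

(* [C_ R a] is convertible to [twist_coef (s R) a]. *)
Definition twist_coef (a : int) : F := (-1) ^ a * s ^ (a - 1) + s ^ (1 - a).

Lemma twist_coef_rec b : twist_rec s (fun m => twist_coef (m + b)).
Proof.
move=> m; rewrite /twist_coef.
(* Shifts by one are split off the exponents, so that the three terms share the remaining powers and
   [field] treats these as atoms. *)
have -> : m + 1 + b - 1 = (m + b - 1) + 1 by ring.
have -> : m + 1 + b = (m + b) + 1 by ring.
have -> : 1 - (m + b + 1) = (1 - (m + b)) - 1 by ring.
have -> : m - 1 + b - 1 = (m + b - 1) - 1 by ring.
have -> : m - 1 + b = (m + b) - 1 by ring.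
have -> : 1 - (m + b - 1) = (1 - (m + b)) + 1 by ring.
rewrite !expfzDr ?oppr_eq0 ?oner_eq0 // !expr1z -!invr_expz !expr1z invrN1.
by field; rewrite expfz_neq0 ?s_neq0.
Qed.

(** At 0, 1 and 2, [twist_coef] is [s + s^-1], 0 and [s + s^-1]; the prefactor is the inverse of
    [s + s^-1]. *)
Lemma twist_coef_delta (a b : 'I_2) :
  s / (s ^+ 2 + 1) * twist_coef ((a : nat)%:Z + (b : nat)%:Z) = (a == b)%:R.
Proof.
case: a b => [[|[|//]] ?] [[|[|//]] ?]; rewrite /twist_coef -val_eqE /=.
- by rewrite expr0z expr1z exprN1; field; rewrite s_neq0.
- by rewrite expr0z expr1z; field.
- by rewrite expr0z expr1z; field.
- by rewrite exprN1 expr1z -exprnP; field; rewrite s_neq0.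
Qed.

(** In each product only the factor at [i] depends on [m], and the recurrence is linear. *)
Lemma sum_prod_twist_coef_rec p (c : F)
    (f : {ffun 'I_p -> 'I_2} -> F) (k : {ffun 'I_p -> int}) (i : 'I_p) :
  twist_rec s (fun m => c * \sum_(j : {ffun 'I_p -> 'I_2})
    (\prod_(l < p) twist_coef (update k i m l + (j l : nat)%:Z)) * f j).
Proof.
move=> m; rewrite mulrCA -mulrDr; congr (c * _).
rewrite mulr_sumr -big_split /=; apply: eq_bigr => j _.
have prodE n : \prod_(l < p) twist_coef (update k i n l + (j l : nat)%:Z) =
    twist_coef (n + (j i : nat)%:Z) *
    \prod_(l < p | l != i) twist_coef (k l + (j l : nat)%:Z).
  rewrite (bigD1 i) //= ffunE eqxx; congr (_ * _).
  by apply: eq_bigr => l /negPf li; rewrite ffunE li.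
by rewrite !prodE (twist_coef_rec (j i : nat)%:Z m); ring.
Qed.

Lemma sum_prod_twist_coef_delta p (f : {ffun 'I_p -> 'I_2} -> F)
    (k : {ffun 'I_p -> 'I_2}) :
  (s / (s ^+ 2 + 1)) ^+ p * \sum_(j : {ffun 'I_p -> 'I_2})
    (\prod_(l < p) twist_coef ((k l : nat)%:Z + (j l : nat)%:Z)) * f j = f k.
Proof.
have prodE (j : {ffun 'I_p -> 'I_2}) : (s / (s ^+ 2 + 1)) ^+ p *
    \prod_(l < p) twist_coef ((k l : nat)%:Z + (j l : nat)%:Z) =
    \prod_(l < p) (k l == j l)%:R.
  (* The p-th power provides one normalizing factor for each index. *)
  rewrite -[p in _ ^+ p]card_ord -prodr_const -big_split /=.
  by apply: eq_bigr => l _; apply: twist_coef_delta.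
rewrite mulr_sumr (bigD1 k) //= mulrA prodE big1 ?mul1r; last first.
  by move=> l _; rewrite eqxx.
rewrite big1 ?addr0 // => j jk; rewrite mulrA prodE.
have [l kjl] : exists l, k l != j l.
  apply/existsP; rewrite -negb_forall; apply: contra jk => /forallP kj.
  by apply/eqP/ffunP => l; rewrite (eqP (kj l)).
by rewrite (bigD1 l) //= (negPf kjl) !mul0r.
Qed.

(** This is the algebraic content of the expansion, to be applied to [nabla \o L]. *)
Lemma multi_twist_recE p (g : {ffun 'I_p -> int} -> F) (k : {ffun 'I_p -> int}) :
  (forall k j, twist_rec s (fun m => g (update k j m))) ->
  g k = (s / (s ^+ 2 + 1)) ^+ p * \sum_(j : {ffun 'I_p -> 'I_2})
     (\prod_(l < p) twist_coef (k l + (j l : nat)%:Z)) *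
     g [ffun l => (j l : nat)%:Z].
Proof.
move=> g_rec.
pose rhs (k : {ffun 'I_p -> int}) := (s / (s ^+ 2 + 1)) ^+ p *
   \sum_(j : {ffun 'I_p -> 'I_2})
     (\prod_(l < p) twist_coef (k l + (j l : nat)%:Z)) *
     g [ffun l => (j l : nat)%:Z].
apply/eqP; rewrite -subr_eq0 -/(rhs k); apply/eqP.
apply: (@multi_twist_rec_eq0 _ s p (fun k => g k - rhs k)).
  move=> k' i m; rewrite (g_rec k' i m).
  by rewrite /rhs (sum_prod_twist_coef_rec _ _ k' i m); ring.
move=> j; rewrite /rhs.
under eq_bigr do under eq_bigr do rewrite ffunE.
by rewrite sum_prod_twist_coef_delta subrr.
Qed.

End TwistCoefficients.

(** * The skein relation inside a disc, and the expansion formula *)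

Lemma s_neq0 (R : realType) : s R != 0.
Proof. by rewrite /s tofrac_eq0 polyX_eq0. Qed.

Lemma sqr_s_add1_neq0 (R : realType) : s R ^+ 2 + 1 != 0.
Proof.
rewrite /s -tofracXn -tofrac1 -tofracD tofrac_eq0.
(* The constant coefficient of ['X^2 + 1] is 1. *)
apply/eqP => /(congr1 (fun q : {poly R[i]} => q`_0)) /eqP.
by rewrite coefD coefXn coef1 coef0 add0r oner_eq0.
Qed.

(** For two strands going down, [Cross false] is the positive crossing and the smoothing is the
    empty word. *)
Lemma skein_parallel (R : realType) (nabla : link_diagram -> ratfun R)
    (Lp Lm L0 : link_diagram) u v i l :
  is_alexander_conway nabla ->
  word_out u [::] = Some l -> strands i 2 l = [:: true; true] ->
  diagram_word Lp = u ++ (i, Cross false) :: v ->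
  diagram_word Lm = u ++ (i, Cross true) :: v ->
  diagram_word L0 = u ++ v ->
  nabla Lm = ((s R)^-1 - s R) * nabla L0 + nabla Lp.
Proof.
move=> [_ _ _ skein] ul il Ep Em E0.
have /skein/eqP : skein_triple Lp Lm L0.
  by exists u, v, i, l, true, true.
by rewrite subr_eq0 subr_eq addrC => /eqP ->; rewrite addrC.
Qed.

Lemma nabla_family_rec (R : realType) (nabla : link_diagram -> ratfun R)
    p (L : {ffun 'I_p -> int} -> link_diagram) k j :
  is_alexander_conway nabla ->
  parallel_braid_family L -> twist_rec (s R) (fun m => nabla (L (update k j m))).
Proof.
move=> Hnabla [T [T_closed T_labels] HL] m.
have [_ nabla_iso _ _] := Hnabla.
have /split_disc[T1 [i [T2 ET]]] : j \in pmap (@disc_label p) T.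
  by rewrite (perm_mem T_labels) mem_enum.
(* The j-th disc occurs only once, so the parts [u] and [v] above and below it do not change with
   its exponent. *)
have : uniq (pmap (@disc_label p) T) by rewrite (perm_uniq T_labels) enum_uniq.
rewrite ET pmap_cat /= cat_uniq /= negb_or => /and3P[_ /andP[jT1 _] /andP[jT2 _]].
set u := fill T1 k; set v := fill T2 k.
have upd n x : x != j -> update k j n x = k x by rewrite ffunE => /negPf ->.
have fillE n : fill T (update k j n) = u ++ twist i n ++ v.
  rewrite ET /fill map_cat flatten_cat /= ffunE eqxx.
  by rewrite -!/(fill _ _) (eq_fill jT1 (upd n)) (eq_fill jT2 (upd n)).
have [l [ul il vl]] : exists l, [/\ word_out u [::] = Some l,
    strands i 2 l = [:: true; true] & word_out v l = Some [::]].
  move: T_closed; rewrite ET template_out_cat.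
  case T1l: template_out => [l|] //=; case: eqP => //= il T2l.
  by exists l; rewrite /u /v (word_out_fill _ T1l) (word_out_fill _ T2l).
(* The skein relation needs words that differ in a single crossing, so an extra crossing is put
   above the twist of exponent [m]; up to isotopy it changes the exponent to [m + 1] or [m - 1], and
   its smoothing leaves [m]. *)
have closed b : word_out (u ++ (i, Cross b) :: twist i m ++ v) [::] = Some [::].
  rewrite word_out_cat ul [obind _ _]word_out_cons.
  by rewrite slice_out_parallel //= word_out_cat word_out_twist.
have crossE b : nabla (LinkDiagram (closed b)) =
    nabla (L (update k j (if b then m + 1 else m - 1))).
  have [D ED DL] := HL (update k j (if b then m + 1 else m - 1)).
  rewrite -(nabla_iso _ _ (isotopic_planar DL)); apply: nabla_iso.
  by apply: (@isotopic_twist_cross _ _ u v i b m); rewrite // ED fillE.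
have [D ED DL] := HL (update k j m).
rewrite -(crossE true) -(crossE false) -(nabla_iso _ _ (isotopic_planar DL)).
by apply: (skein_parallel Hnabla ul il); rewrite // ED fillE.
Qed.

Theorem corollary1p6 (R : realType)
    (nabla : link_diagram -> ratfun R) (Hnabla : is_alexander_conway nabla)
    (p : nat) (L : {ffun 'I_p -> int} -> link_diagram)
    (HL : parallel_braid_family L) (k : {ffun 'I_p -> int}) :
  (nabla (L k) =
   (s R / (s R ^+ 2 + 1)) ^+ p *
   \sum_(j : {ffun 'I_p -> 'I_2})
     (\prod_(l < p) C_ R (k l + (j l : nat)%:Z)) *
     nabla (L [ffun l => (j l : nat)%:Z]))%R.
Proof.
apply: (@multi_twist_recE _ (s R) (s_neq0 R) (sqr_s_add1_neq0 R) p (nabla \o L)).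
by move=> k' j; apply: nabla_family_rec Hnabla HL.
Qed.
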